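(* Let $k$ be an algebraically closed field and, for each positive integer $n$, let $\Lambda_n = k[x]/(x^n)$. If $n$ and $m$ are positive integers with $n\leq 6$ and $m\neq n$, then $\Lambda_n$ and $\Lambda_m$ are not separably equivalent.
   Context: Two finite dimensional $k$-algebras $A$ and $B$ are separably equivalent if there are bimodules ${}_AM_B$ and ${}_BN_A$ (with $k$ acting centrally), each finitely generated and projective as a left module and as a right module, together with bimodules ${}_AX_A$, ${}_BY_B$ and bimodule isomorphisms $M\otimes_B N\cong A\oplus X$ and $N\otimes_A M\cong B\oplus Y$. *)

(* Defs.v *)
From HB Require Import structures.
From mathcomp Require Import all_boot all_order all_algebra all_field.
From mathcomp Require Import boolp.
From mathcomp.multinomials Require Import freeg.

Set Implicit Arguments.
Unset Strict Implicit.
Unset Printing Implicit Defensive.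

Import GRing.Theory.
Local Open Scope ring_scope.
Local Open Scope quotient_scope.

(* For a monic h of degree at least 1, {poly %/ h} is k[x]/(h); only the
   finite-dimensional algebra structure has to be declared. *)
HB.instance Definition _ (k : fieldType) (h : {poly k}) :=
  Vector.on {poly %/ h}.
HB.instance Definition _ (k : fieldType) (h : {poly k}) :=
  Falgebra.on {poly %/ h}.

(* Meaningful for 0 < n: {poly %/ 'X^0} is by convention {poly %/ 'X}. *)
Definition trunc_poly (k : fieldType) (n : nat) : falgType k :=
  {poly %/ ('X^n : {poly k})}.

Section Modules.
Variables (R : pzRingType) (M : lmodType R).

Definition finitely_generated : Prop :=
  exists (n : nat) (g : 'I_n -> M),
    forall x : M, exists c : 'I_n -> R, x = \sum_(i < n) c i *: g i.

Definition projective : Prop :=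
  forall (U V : lmodType R) (p : {linear U -> V}) (f : {linear M -> V}),
    (forall v, exists u, p u = v) ->
    exists g : {linear M -> U}, forall x, p (g x) = f x.

End Modules.

(* The left action is the [lmodType] structure; [ractC] says that k acts
   centrally. *)
HB.mixin Record isBimodule (k : pzRingType) (A B : algType k) M
    of GRing.Lmodule A M := {
  ract : M -> B -> M;
  ractA : forall m b c, ract (ract m b) c = ract m (b * c);
  ract1 : forall m, ract m 1 = m;
  ractDl : forall m m' b, ract (m + m') b = ract m b + ract m' b;
  ractDr : forall m b c, ract m (b + c) = ract m b + ract m c;
  ractZ : forall (a : A) m b, ract (a *: m) b = a *: ract m b;
  ractC : forall (c : k) m, ract m c%:A = c%:A *: m
}.

#[short(type="bimodType")]
HB.structure Definition Bimodule (k : pzRingType) (A B : algType k) :=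
  {M of GRing.Lmodule A M & isBimodule k A B M}.

Notation "m *> b" := (ract m b) (at level 40, left associativity) : ring_scope.

(* M seen as a right B-module, i.e. as a left module over the converse ring. *)
Definition right_module (k : pzRingType) (A B : algType k)
  (M : bimodType A B) : Type := M.

Section RightModule.
Variables (k : pzRingType) (A B : algType k) (M : bimodType A B).
HB.instance Definition _ := GRing.Zmodule.on (right_module M).
Let rscale (b : B^c) (m : right_module M) : right_module M := (m : M) *> b.
Let rscaleA b c m : rscale b (rscale c m) = rscale (b * c) m.
Proof. exact: ractA. Qed.
Let rscale1 : left_id 1 rscale.
Proof. exact: ract1. Qed.
Let rscaleDr : right_distributive rscale +%R.
Proof. by move=> b m m'; apply: ractDl. Qed.
Let rscaleDl m : {morph rscale^~ m : b c / b + c}.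
Proof. by move=> b c; apply: ractDr. Qed.
HB.instance Definition _ := GRing.Zmodule_isLmodule.Build B^c (right_module M)
  rscaleA rscale1 rscaleDr rscaleDl.
End RightModule.

Section Regular.
Variables (k : pzRingType) (A : algType k).
Let rmul (x : A^o) (a : A) : A^o := (x : A) * a.
Let rmulA m b c : rmul (rmul m b) c = rmul m (b * c).
Proof. by rewrite /rmul mulrA. Qed.
Let rmul1 m : rmul m 1 = m.
Proof. exact: mulr1. Qed.
Let rmulDl m m' b : rmul (m + m') b = rmul m b + rmul m' b.
Proof. exact: mulrDl. Qed.
Let rmulDr m b c : rmul m (b + c) = rmul m b + rmul m c.
Proof. exact: mulrDr. Qed.
Let rmulZ (a : A) m b : rmul (a *: m) b = a *: rmul m b.
Proof. by exact/esym/mulrA. Qed.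
Let rmulC (c : k) m : rmul m c%:A = c%:A *: m.
Proof. by rewrite /rmul -scalerAr mulr1 [RHS]mulr_algl. Qed.
HB.instance Definition _ := isBimodule.Build k A A A^o
  rmulA rmul1 rmulDl rmulDr rmulZ rmulC.
End Regular.

Section Sum.
Variables (k : pzRingType) (A B : algType k) (M N : bimodType A B).
Let act (x : M * N) (b : B) : M * N := (x.1 *> b, x.2 *> b).
Let actA m b c : act (act m b) c = act m (b * c).
Proof. by rewrite /act !ractA. Qed.
Let act1 m : act m 1 = m.
Proof. by case: m => m n; rewrite /act !ract1. Qed.
Let actDl m m' b : act (m + m') b = act m b + act m' b.
Proof. by rewrite /act !ractDl. Qed.
Let actDr m b c : act m (b + c) = act m b + act m c.
Proof. by rewrite /act !ractDr. Qed.
Let actZ (a : A) m b : act (a *: m) b = a *: act m b.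
Proof. by rewrite /act !ractZ. Qed.
Let actC (c : k) m : act m c%:A = c%:A *: m.
Proof. by rewrite /act !ractC. Qed.
HB.instance Definition _ := isBimodule.Build k A B (M * N)%type
  actA act1 actDl actDr actZ actC.
End Sum.

Definition bimod_iso (k : pzRingType) (A B : algType k)
    (M N : bimodType A B) : Prop :=
  exists2 f : {linear M -> N},
    bijective f & forall m (b : B), f (m *> b) = f m *> b.

Section Tensor.
Variables (k : pzRingType) (A B C : algType k).
Variables (M : bimodType A B) (N : bimodType B C).

(* The free abelian group on the set M * N, with basis elements << z >>. *)
Notation free := {freeg (M * N)%type}.

Inductive tensor_relator : free -> Prop :=
| TensorDl m m' n :
    tensor_relator (<< (m + m', n) >> - << (m, n) >> - << (m', n) >>)
| TensorDr m n n' :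
    tensor_relator (<< (m, n + n') >> - << (m, n) >> - << (m, n') >>)
| TensorB m (b : B) n :
    tensor_relator (<< (m *> b, n) >> - << (m, b *: n) >>).

(* The subgroup generated by the relators. *)
Definition tensor_null : {pred free} := fun x =>
  `[< forall S : {pred free}, zmod_closed S ->
        (forall r, tensor_relator r -> r \in S) -> x \in S >].

Lemma tensor_null_zmod_closed : zmod_closed tensor_null.
Proof.
split=> [|x y /asboolP xP /asboolP yP]; apply/asboolP => S clS relS.
  by case: clS.
by case: (clS) => _; apply; [apply: xP | apply: yP].
Qed.
HB.instance Definition _ :=
  GRing.isZmodClosed.Build free tensor_null tensor_null_zmod_closed.

Lemma tensor_relator_null r : tensor_relator r -> r \in tensor_null.
Proof. by move=> rr; apply/asboolP => S _; apply. Qed.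

Definition tensor : Type := {ideal_quot tensor_null}.
HB.instance Definition _ := GRing.Zmodule.on tensor.
HB.instance Definition _ := Quotient.on tensor.

Definition tens (m : M) (n : N) : tensor := \pi << (m, n) >>.

Definition balanced (V : zmodType) (f : M -> N -> V) : Prop :=
  [/\ forall m m' n, f (m + m') n = f m n + f m' n,
      forall m n n', f m (n + n') = f m n + f m n'
    & forall m (b : B) n, f (m *> b) n = f m (b *: n)].

Let piq : {additive free -> {ideal_quot tensor_null}} := \pi.

Lemma pi_tensorB (x y : free) : \pi_tensor (x - y) = \pi x - \pi y.
Proof. exact: (raddfB (piq)). Qed.

Lemma tens_balanced : balanced tens.
Proof.
have rel0 r : tensor_relator r -> \pi_tensor r = 0.
  move=> /tensor_relator_null; rewrite -[r]subr0 Quotient.idealrBE => /eqP.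
  by rewrite subr0 => ->; apply: (raddf0 piq).
split=> [m m' n|m n n'|m b n]; apply/eqP; rewrite -subr_eq0 ?opprD ?addrA -!pi_tensorB.
- exact/eqP/rel0/TensorDl.
- exact/eqP/rel0/TensorDr.
- exact/eqP/rel0/TensorB.
Qed.

Section Lift.
Variables (V : zmodType) (f : M -> N -> V).

Definition free_lift (x : free) : V :=
  fglift (fun z : (M * N)%type => f z.1 z.2 : zmodule V) x.

Definition tensor_lift (t : tensor) : V := free_lift (repr t).

Lemma free_liftB : zmod_morphism free_lift.
Proof.
pose g (z : (M * N)%type) : zmodule V := f z.1 z.2.
exact: (lift_is_additive g).
Qed.

Lemma free_liftU m n : free_lift << (m, n) >> = f m n.
Proof. by rewrite /free_lift liftU scale1r. Qed.

Hypothesis fP : balanced f.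

Lemma tensor_lift_pi x : tensor_lift (\pi x) = free_lift x.
Proof.
have: repr (\pi_tensor x) - x \in tensor_null.
  by rewrite Quotient.idealrBE; apply/eqP; rewrite reprK.
move/asboolP/(_ [pred y | free_lift y == 0]); rewrite inE free_liftB subr_eq0.
have f0 : free_lift 0 = 0 by rewrite -{1}[0]subr0 free_liftB subrr.
move=> h; apply/eqP/h => [|r rr].
  split=> [|y z]; rewrite !inE ?f0 // free_liftB => /eqP-> /eqP->.
  by rewrite subrr.
rewrite inE; case: fP => fDl fDr fB.
case: rr => *; rewrite !free_liftB !free_liftU ?(fDl, fDr, fB).
- by rewrite addrAC addrK subrr.
- by rewrite addrAC addrK subrr.
- by rewrite subrr.
Qed.

Lemma tensor_liftB : zmod_morphism tensor_lift.
Proof.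
elim/quotW=> x; elim/quotW=> y.
by rewrite -[_ - _]pi_tensorB !tensor_lift_pi free_liftB.
Qed.

Lemma tensor_liftE m n : tensor_lift (tens m n) = f m n.
Proof. by rewrite tensor_lift_pi free_liftU. Qed.

End Lift.

Lemma tensor_ext (V : zmodType) (f g : tensor -> V) :
  zmod_morphism f -> zmod_morphism g ->
  (forall m n, f (tens m n) = g (tens m n)) -> f =1 g.
Proof.
move=> fB gB fg; elim/quotW=> x.
pose F := GRing.isZmodMorphism.Build _ _ f fB.
pose f' : {additive tensor -> V} := HB.pack f F.
pose G := GRing.isZmodMorphism.Build _ _ g gB.
pose g' : {additive tensor -> V} := HB.pack g G.
rewrite -[x]freeg_sumE -[f]/(f' : _ -> _) -[g]/(g' : _ -> _).
rewrite (raddf_sum piq) !raddf_sum; apply: eq_bigr => -[m n] _.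
rewrite -[coeff _ _]intz -freegU_mulz.
by rewrite (raddfMz piq) !raddfMz; congr (_ *~ _); apply: fg.
Qed.

Let lmul (a : A) : tensor -> tensor := tensor_lift (fun m n => tens (a *: m) n).
Let rmul (t : tensor) (c : C) : tensor :=
  tensor_lift (fun m n => tens m (n *> c)) t.

Let lmul_balanced a : balanced (fun m n => tens (a *: m) n).
Proof.
case: tens_balanced => tDl tDr tB.
by split=> *; rewrite ?scalerDr ?tDl ?tDr // -ractZ tB.
Qed.

Let rmul_balanced c : balanced (fun m n => tens m (n *> c)).
Proof.
case: tens_balanced => tDl tDr tB.
by split=> *; rewrite ?ractDl ?tDl ?tDr // tB ractZ.
Qed.

Let lmulB a : zmod_morphism (lmul a).
Proof. exact: tensor_liftB. Qed.
Let rmulB c : zmod_morphism (rmul^~ c).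
Proof. exact: tensor_liftB. Qed.
Let lmulE a m n : lmul a (tens m n) = tens (a *: m) n.
Proof. exact: tensor_liftE. Qed.
Let rmulE c m n : rmul (tens m n) c = tens m (n *> c).
Proof. exact: tensor_liftE. Qed.

Let zmod_comp (U V W : zmodType) (f : V -> W) (g : U -> V) :
  zmod_morphism f -> zmod_morphism g -> zmod_morphism (f \o g).
Proof. by move=> fB gB x y /=; rewrite gB fB. Qed.

Let zmod_add (U V : zmodType) (f g : U -> V) :
  zmod_morphism f -> zmod_morphism g -> zmod_morphism (fun x => f x + g x).
Proof. by move=> fB gB x y /=; rewrite gB fB opprD addrACA. Qed.

Let zmod_id (U : zmodType) : zmod_morphism (@id U).
Proof. by []. Qed.

Let lmulA a b t : lmul a (lmul b t) = lmul (a * b) t.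
Proof.
apply: (tensor_ext (zmod_comp (lmulB a) (lmulB b)) (lmulB (a * b))) t => m n /=.
by rewrite !lmulE scalerA.
Qed.
Let lmul1 : left_id 1 lmul.
Proof.
move=> t; apply: (tensor_ext (lmulB 1) (zmod_id (U := tensor))) t => m n.
by rewrite lmulE scale1r.
Qed.
Let lmulDr : right_distributive lmul +%R.
Proof.
move=> a t u; have a0 : lmul a 0 = 0 by rewrite -{1}[0]subr0 lmulB subrr.
by rewrite -{1}[u]opprK lmulB -[- u]add0r lmulB a0 sub0r opprK.
Qed.
Let lmulDl t : {morph lmul^~ t : a b / a + b}.
Proof.
move=> a b.
apply: (tensor_ext (lmulB (a + b)) (zmod_add (lmulB a) (lmulB b))) t => m n.
by case: tens_balanced => tDl _ _; rewrite !lmulE scalerDl tDl.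
Qed.
HB.instance Definition _ :=
  GRing.Zmodule_isLmodule.Build A tensor lmulA lmul1 lmulDr lmulDl.

Lemma tensZl a m n : a *: tens m n = tens (a *: m) n.
Proof. exact: lmulE. Qed.

Let rmulA t b c : rmul (rmul t b) c = rmul t (b * c).
Proof.
apply: (tensor_ext (zmod_comp (rmulB c) (rmulB b)) (rmulB (b * c))) t => m n /=.
by rewrite !rmulE ractA.
Qed.
Let rmul1 t : rmul t 1 = t.
Proof.
apply: (tensor_ext (rmulB 1) (zmod_id (U := tensor))) t => m n.
by rewrite rmulE ract1.
Qed.
Let rmulDl t u c : rmul (t + u) c = rmul t c + rmul u c.
Proof.
have c0 : rmul 0 c = 0 by rewrite -{1}[0]subr0 rmulB subrr.
by rewrite -{1}[u]opprK rmulB -[- u]add0r rmulB c0 sub0r opprK.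
Qed.
Let rmulDr t b c : rmul t (b + c) = rmul t b + rmul t c.
Proof.
apply: (tensor_ext (rmulB (b + c)) (zmod_add (rmulB b) (rmulB c))) t => m n.
by case: tens_balanced => _ tDr _; rewrite !rmulE ractDr tDr.
Qed.
Let rmulZ a t c : rmul (a *: t) c = a *: rmul t c.
Proof.
apply: (tensor_ext (zmod_comp (rmulB c) (lmulB a))
                   (zmod_comp (lmulB a) (rmulB c))) t => m n /=.
by rewrite lmulE !rmulE lmulE.
Qed.
Let rmulC (c : k) t : rmul t c%:A = c%:A *: t.
Proof.
apply: (tensor_ext (rmulB c%:A) (lmulB c%:A)) t => m n.
case: tens_balanced => _ _ tB.
by rewrite rmulE lmulE -ractC tB ractC.
Qed.
HB.instance Definition _ :=
  isBimodule.Build k A C tensor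
  rmulA rmul1 rmulDl rmulDr rmulZ rmulC.

Lemma tens_act m n (c : C) : tens m n *> c = tens m (n *> c).
Proof. exact: rmulE. Qed.

End Tensor.

Definition biprojective (k : pzRingType) (A B : algType k)
    (M : bimodType A B) : Prop :=
  [/\ finitely_generated M, projective M,
      finitely_generated (right_module M) & projective (right_module M)].

Definition separably_equivalent (k : fieldType) (A B : falgType k) : Prop :=
  exists (M : bimodType A B) (N : bimodType B A)
         (X : bimodType A A) (Y : bimodType B B),
  [/\ biprojective M, biprojective N,
      bimod_iso (tensor M N) (A^o * X)%type
    & bimod_iso (tensor N M) (B^o * Y)%type].

(* Main.v *)
From HB Require Import structures.
Require Import Defs.
From mathcomp Require Import all_boot all_order all_algebra all_field.
From mathcomp Require Import zify.

(** Suppose n < m, A = k[x]/(x^n), B = k[y]/(y^m), and B is a direct summand of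
    N (x)_A M as a bimodule, with M finitely generated projective over A.  This
    leads to a contradiction; a separable equivalence provides such a summand
    for either order of the two algebras, hence forces n = m.

    Extracting a matrix problem ([split_trace]).  Let phi : N (x)_A M -> B be
    the projection and e the image of 1 in N (x)_A M, so that b e = e b.  Let
    top_A and top_B be the coefficients of x^(n-1) and y^(m-1).  As top_A is a
    Frobenius form, each u in N defines an A-linear form lam_u on M by
    top_A (lam_u v) = top_B (phi (u (x) v)), and u (x) v |-> lam_u(-) v maps
    N (x)_A M to End_A(M).  The image W of e commutes with the right action of
    B, and top_A (tr_A (W b)) = top_B (phi (e b)) = top_B b.  A dual basis of M
    turns W and the action Y of y into matrices over A with Y^m = 0, W Y = Y W
    and top_A (tr (Y^(m-1) W)) = 1.

    No such matrices exist ([trunc_trace_eq0]).  Lift Y and W to matrices over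
    k[x].  Then Y^m is divisible by x^n and Y, W commute modulo x^n.
    Heuristically Y has x-adic slopes at least n/m, so those of
    Z = Y^(m-1) W are at least n(m-1)/m = n - n/m > n - 1, and the trace of Z
    must be divisible by x^n.  Precisely, x^(n(m-1)) divides Z^m
    ([exp_pred_mul_factor]), and a Gauss lemma argument on the characteristic
    polynomial converts this into the divisibility of the trace
    ([dvdp_trace_of_exp]). *)

Set Implicit Arguments.
Unset Strict Implicit.
Unset Printing Implicit Defensive.

Import GRing.Theory.
Local Open Scope ring_scope.

(** * Slopes of a product of almost commuting elements *)

(** Write Z = Y^(m-1) W.  If Y and W commuted, Z^j would be Y^(j(m-1)) W^j, and
    j(m-1) = (j-1) m + (m-j) gives the factor t^(j-1) Y^(m-j).  Moving a W to
    the right past a power of Y costs an error divisible by t, which is as good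
    as the factor Y^m that the move would have produced; keeping Y^(m-j) in the
    statement makes the induction go through. *)
Lemma exp_pred_mul_factor (R : comPzRingType) (E : algType R)
    (t : R) (Y W P C : E) (m : nat) :
  Y ^+ m = t *: P -> W * Y = Y * W + t *: C ->
  forall j, (j < m)%N ->
  exists e, (Y ^+ m.-1 * W) ^+ j.+1 = t ^+ j *: (Y ^+ (m - j.+1) * e).
Proof.
move=> Ym WY; elim=> [|j IHj] lt_jm.
  by exists W; rewrite expr1 expr0 scale1r subn1.
have [e IH] := IHj (ltnW lt_jm).
have [D WYi] : exists D, W * Y ^+ (m - j.+1) = Y ^+ (m - j.+1) * W + t *: D.
  elim: (m - j.+1)%N => [|i [D IHi]].
    by exists 0; rewrite expr0 mulr1 mul1r scaler0 addr0.
  exists (Y * D + C * Y ^+ i).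
  rewrite exprS mulrA WY mulrDl -mulrA IHi mulrDr !mulrA -addrA.
  by rewrite scalerDr -scalerAr -scalerAl.
exists (P * W * e + Y ^+ j.+1 * D * e).
rewrite exprS IH -scalerAr [t ^+ j.+1]exprSr -scalerA; congr (_ *: _).
rewrite !mulrA -[_ * W * Y ^+ _]mulrA WYi mulrDr mulrDl -scalerAr -scalerAl.
rewrite mulrA -exprD mulrDr scalerDr !mulrA.
(* The main term gains one more full power Y^m. *)
have -> : (m.-1 + (m - j.+1) = m - j.+2 + m)%N by lia.
rewrite exprD Ym -scalerAr -!scalerAl -exprD.
by have -> : (m - j.+2 + j.+1 = m.-1)%N by lia.
Qed.

(** * The trace of a matrix over k[x] with a divisible power *)

Section TraceDivisibility.
Variable k : fieldType.
Implicit Types P : {poly {poly k}}.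
Local Notation mod0 := (map_poly (horner_eval (0 : k))).

Lemma mod0_factor P : P != 0 ->
  exists a P', P = 'X^a *: P' /\ mod0 P' != 0.
Proof.
have [s leP] := ubnP (size (lead_coef P)); elim: s => // s IH in P leP *.
move: leP; rewrite ltnS => leP P0; have [P00|] := eqVneq (mod0 P) 0; last first.
  by exists 0%N, P; rewrite expr0 scale1r.
pose Q := map_poly (fun c : {poly k} => c %/ 'X) P.
have PQ : P = 'X *: Q.
  apply/polyP => i; rewrite coefZ coef_map_id0 ?div0p // mulrC divpK //.
  by have := congr1 (fun p : {poly k} => p`_i) P00;
     rewrite coef_map coef0 /= /horner_eval -['X]subr0 dvdp_XsubCl => /eqP.
have Q0 : Q != 0 by apply: contraNneq P0 => Q0; rewrite PQ Q0 scaler0.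
have [|a [P' [QE P'0]]] := IH Q _ Q0.
  by move: leP; rewrite PQ lead_coefZ mulrC size_mulX // lead_coef_eq0.
by exists a.+1, P'; rewrite exprS -scalerA -QE.
Qed.

(** The exponent a below is the valuation on k[x][T] that extends the x-adic
    one coefficientwise.  Reduction modulo x is a morphism to the domain k[T],
    so cofactors with nonzero reduction multiply to such a cofactor: with
    uniqueness of the exponent this is Gauss's lemma at the prime x. *)
Lemma mod0_factor_uniq a b P Q : mod0 P != 0 -> mod0 Q != 0 ->
  'X^a *: P = 'X^b *: Q -> a = b /\ P = Q.
Proof.
wlog le_ab : a b P Q / (a <= b)%N => [hw|] P0 Q0 E.
  have [/hw|/ltnW/hw] := leqP a b; first exact.
  by move=> /(_ _ _ Q0 P0 (esym E)) [-> ->].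
have {}E : P = 'X^(b - a) *: Q.
  have Xa0 : ('X^a : {poly k})%:P != 0 by rewrite polyC_eq0 expf_eq0 polyX_eq0 andbF.
  by apply: (mulfI Xa0); rewrite !mul_polyC scalerA -exprD subnKC.
have [e0|ba0] := posnP (b - a)%N.
  split; last by rewrite E e0 expr0 scale1r.
  by apply/eqP; rewrite eqn_leq le_ab -subn_eq0 e0.
move: P0; rewrite E map_polyZ /= /horner_eval hornerXn expr0n.
by rewrite gtn_eqF // scale0r eqxx.
Qed.

Lemma coef_char_poly_scale r (a : {poly k}) (Z : 'M[{poly k}]_r) i :
  (char_poly Z \Po (a *: 'X))`_i = a ^+ i * (char_poly Z)`_i.
Proof.
rewrite coef_comp_poly size_char_poly.
have e j : (char_poly Z)`_j * ((a *: 'X) ^+ j)`_i =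
   if j == i then a ^+ i * (char_poly Z)`_i else 0.
  rewrite exprZn coefZ coefXn eq_sym; case: eqP => [->|_]; last by rewrite !mulr0.
  by rewrite mulr1 mulrC.
under eq_bigr do rewrite e; rewrite -big_mkcond /=.
have [ltir|leri] := ltnP i r.+1; first by rewrite (big_pred1 (Ordinal ltir)).
rewrite big_pred0 => [|j]; last by apply/negbTE; rewrite neq_ltn (leq_trans (ltn_ord j)).
by rewrite nth_default ?mulr0 ?size_char_poly.
Qed.

(** The matrix x^-c Z has N-th power x Q, so it is integral over k[x] and
    nilpotent modulo x; this is why its trace vanishes modulo x.  The rescaled
    characteristic polynomial det (x^c T - Z) divides
    det ((x^c T)^N - Z^N) = x^(c N r) det (T^N - x Q), whose last factor
    reduces to a power of T modulo x.  After removing powers of x, Gauss's lemma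
    and unique factorisation in k[T] leave a power of T as the reduction of
    det (T - x^-c Z). *)
Lemma dvdp_trace_of_exp r c N (Z Q : 'M[{poly k}]_r) : (0 < N)%N ->
  Z ^+ N = 'X^((c * N).+1) *: Q -> 'X^(c.+1) %| \tr Z.
Proof.
case: r Z Q => [|r] Z Q N0 ZN; first by rewrite /mxtrace big_ord0 dvdp0.
set p := char_poly Z.
pose D := map_mx (comp_poly ('X^c *: 'X)) (char_poly_mx Z).
have detD : \det D = p \Po ('X^c *: 'X) by rewrite det_map_mx.
pose H := char_poly ('X *: Q) \Po 'X^N.
have [q pq] : exists q, \det D * q = 'X^(c * N * r.+1) *: H.
  pose x : 'M[{poly {poly k}}]_r.+1 := ('X^c *: 'X)%:M.
  pose z : 'M[{poly {poly k}}]_r.+1 := map_mx polyC Z.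
  have DE : D = x - z.
    rewrite /D /char_poly_mx map_mxB map_scalar_mx /= comp_polyX; congr (_ - _).
    by apply/matrixP => i j; rewrite !mxE comp_polyC.
  have xz : GRing.comm x z by rewrite /GRing.comm; apply/esym/scalar_mxC.
  exists (\det (\sum_(i < N) x ^+ (N.-1 - i) * z ^+ i)).
  rewrite -det_mulmx DE -[_ *m _]/(_ * _) -subrXX_comm //.
  have -> : x ^+ N - z ^+ N = ('X^(c * N))%:P *:
      map_mx (comp_poly 'X^N) (char_poly_mx ('X *: Q)).
    have -> : x ^+ N = (('X^c *: 'X) ^+ N)%:M.
      by elim: (N) => [|i IH]; rewrite ?expr0 // !exprS IH -[RHS]/(_%:M) scalar_mxM.
    have -> : z ^+ N = map_mx polyC (Z ^+ N).
      elim: (N) => [|i IH]; first by rewrite !expr0 map_mx1.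
      by rewrite !exprS IH map_mxM.
    rewrite ZN; apply/matrixP => i j; rewrite !mxE /= exprZn -exprM.
    rewrite rmorphB rmorphMn /= comp_polyX comp_polyC mul_polyC scalerBr.
    by rewrite scalerMnr exprSr -mulrA [in LHS]polyCM mul_polyC.
  by rewrite detZ det_map_mx -mul_polyC -polyC_exp -exprM.
have rhoH : mod0 H = 'X^(N * r.+1).
  rewrite map_comp_poly map_char_poly map_polyXn.
  have -> : map_mx (horner_eval 0) ('X *: Q) = 0.
    by apply/matrixP => i j; rewrite !mxE /= /horner_eval hornerM hornerX mul0r.
  rewrite char_poly_trig; last by apply/is_trig_mxP => i j _; rewrite mxE.
  under eq_bigr do rewrite mxE subr0.
  by rewrite prodr_const card_ord rmorphXn /= comp_polyX -exprM.
have monH : H \is monic.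
  rewrite monicE lead_coef_comp ?size_polyXn // lead_coefXn expr1n mulr1.
  by rewrite -monicE char_poly_monic.
have sizecX : size ('X^c *: 'X : {poly {poly k}}) = 2%N.
  by rewrite -mul_polyC size_Cmul ?size_polyX // expf_eq0 polyX_eq0 andbF.
have [a [P [DP P0]]] : exists a P', \det D = 'X^a *: P' /\ mod0 P' != 0.
  apply: mod0_factor; rewrite detD comp_poly2_eq0 ?monic_neq0 ?char_poly_monic //.
have [b [S [qS S0]]] : exists a P', q = 'X^a *: P' /\ mod0 P' != 0.
  apply: mod0_factor; apply/eqP => q0; move/eqP: pq.
  rewrite q0 mulr0 eq_sym -mul_polyC mulf_eq0 polyC_eq0 expf_eq0 polyX_eq0 andbF /=.
  by rewrite (negPf (monic_neq0 monH)).
have [_ PSH] : (a + b = c * N * r.+1)%N /\ P * S = H.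
  apply: mod0_factor_uniq; rewrite ?rhoH ?rmorphM ?mulf_neq0 //.
    by rewrite expf_eq0 polyX_eq0 andbF.
  by rewrite -pq DP qS exprD -scalerAr -scalerAl scalerA mulrC.
have Pi i : 'X^a * P`_i = ('X^c) ^+ i * (char_poly Z)`_i.
  by rewrite -coef_char_poly_scale -detD DP coefZ.
have sizeP : size P = r.+2.
  rewrite -(size_char_poly Z) -(size_comp_poly2 (char_poly Z) sizecX) -detD DP.
  by rewrite -mul_polyC size_Cmul // expf_eq0 polyX_eq0 andbF.
(* The leading coefficients of P and S are inverse to each other. *)
have leadP : size P`_r.+1 = 1%N.
  have : lead_coef P * lead_coef S = 1 by rewrite -lead_coefM PSH (monicP monH).
  move/(congr1 (size \o polyseq))/eqP; rewrite /= size_poly1 size_mul_eq1.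
  by case/andP => /eqP; rewrite lead_coefE sizeP.
have aE : a = (c * r.+1)%N.
  have := Pi r.+1; have := char_poly_monic Z; rewrite monicE lead_coefE.
  rewrite size_char_poly => /eqP ->; rewrite mulr1 -exprM.
  move/(congr1 (size \o polyseq)); rewrite /= size_polyXn mulrC.
  by rewrite size_mulXn -?size_poly_gt0 leadP // addn1 => -[].
(* mod0 P divides a power of T, and its degree is the size of Z. *)
have : 'X %| P`_r.
  have [v v0 Pv] := size_poly1P _ (introT eqP leadP).
  have size0P : size (mod0 P) = r.+2.
    rewrite size_map_poly_id0 // lead_coefE sizeP /= Pv.
    by rewrite /horner_eval hornerC.
  have : mod0 P %| ('X - 0%:P) ^+ (N * r.+1) by rewrite subr0 -rhoH -PSH rmorphM dvdp_mulr.
  case/dvdp_exp_XsubCP => d _; rewrite subr0 => Pd.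
  have dE : d = r.+1 by have := eqp_size Pd; rewrite size0P size_polyXn => -[].
  case/eqpP: Pd => -[u w] /= /andP[u0 w0] /(congr1 (fun p : {poly k} => p`_r)).
  rewrite !coefZ coefXn dE ltn_eqF // mulr0 => /eqP; rewrite mulf_eq0 (negPf u0).
  by rewrite coef_map /= /horner_eval -['X]subr0 dvdp_XsubCl.
case/dvdpP => u Pr; have := Pi r.
rewrite (char_poly_trace Z (ltn0Sn r)) Pr aE -exprM mulnS addnC exprD mulrN -!mulrA.
rewrite -mulrN => /mulfI; rewrite expf_eq0 polyX_eq0 andbF => /(_ isT) E.
by apply/dvdpP; exists (- u); rewrite -[\tr Z]opprK -E exprSr mulNr mulrCA.
Qed.
End TraceDivisibility.

(** * Matrices over k[x]/(x^n) *)

Section TruncatedPolynomials.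
Variables (k : fieldType) (n : nat).
Hypothesis n_gt0 : (0 < n)%N.
Local Notation L := {poly %/ ('X^n : {poly k})}.

Lemma mk_monicXn : mk_monic ('X^n) = 'X^n :> {poly k}.
Proof. by rewrite mk_monic_Xn prednK. Qed.

Lemma val_in_qpoly p : in_qpoly 'X^n p = p %% 'X^n :> {poly k}.
Proof. by rewrite /= mk_monicXn -Pdiv.IdomainMonic.modpE // monicXn. Qed.

Lemma in_qpoly_eq0 p : (in_qpoly 'X^n p == 0 :> L) = ('X^n %| p).
Proof. by rewrite -val_eqE /= mk_monicXn -Pdiv.IdomainMonic.modpE // monicXn. Qed.

Lemma size_trunc (a : L) : (size (a : {poly k}) <= n)%N.
Proof.
by rewrite -ltnS -(size_polyXn k n) (leq_trans (size_mk_monic a)) ?mk_monicXn.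
Qed.

Lemma in_qpolyK (a : L) : in_qpoly 'X^n a = a.
Proof. by apply/val_inj/in_qpoly_small/size_mk_monic. Qed.

(** The lifts satisfy (Y^(m-1) W)^m = x^(n(m-1)) e, and n < m gives
    n(m-1) >= (n-1) m + 1, which is the bound required for x^n to divide the
    trace. *)
Lemma trunc_trace_eq0 m r (Y W : 'M[L]_r) : (n < m)%N ->
  Y ^+ m = 0 -> W *m Y = Y *m W -> \tr (Y ^+ m.-1 *m W) = 0.
Proof.
case: r Y W => [|r] Y W lt_nm Ym WY; first by rewrite /mxtrace big_ord0.
pose red := map_mx (in_qpoly ('X^n : {poly k})) : 'M_r.+1 -> 'M_r.+1.
pose lift := map_mx (fun a : L => a : {poly k}) : 'M_r.+1 -> 'M_r.+1.
have liftK Z : red (lift Z) = Z by apply/matrixP => i j; rewrite !mxE in_qpolyK.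
have redX Z i : red (Z ^+ i) = red Z ^+ i.
  elim: i => [|i IH]; first by rewrite !expr0 /red map_mx1.
  by rewrite !exprS -IH /red map_mxM.
have red0 Z : red Z = 0 -> exists P, Z = 'X^n *: P.
  move=> Z0; exists (map_mx (fun p => p %/ 'X^n) Z); apply/matrixP => i j.
  have := congr1 (fun Z : 'M_r.+1 => Z i j) Z0; rewrite !mxE => /eqP.
  by rewrite in_qpoly_eq0 mulrC => /divpK ->.
have [P YmP] : exists P, lift Y ^+ m = 'X^n *: P.
  by apply: red0; rewrite redX liftK.
have [C CE] : exists C, lift W * lift Y - lift Y * lift W = 'X^n *: C.
  by apply: red0; rewrite /red map_mxB !map_mxM -/red !liftK WY subrr.
have {}CE : lift W * lift Y = lift Y * lift W + 'X^n *: C by rewrite -CE addrC subrK.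
have [|e] := exp_pred_mul_factor YmP CE (j := m.-1); first by lia.
rewrite prednK; last by lia.
rewrite subnn expr0 mul1r -exprM => E.
have : 'X^(n.-1.+1) %| \tr (lift Y ^+ m.-1 * lift W).
  apply: (@dvdp_trace_of_exp _ _ _ m _ ('X^(m - n.+1) *: e)); first by lia.
  rewrite E scalerA -exprD; congr ('X^ _ *: _); nia.
rewrite prednK // -in_qpoly_eq0 => /eqP <-.
rewrite -[in LHS](liftK Y) -[in LHS](liftK W) -redX /red -map_mxM.
by rewrite /mxtrace raddf_sum; apply: eq_bigr => i _; rewrite mxE.
Qed.

Definition top_coef (a : L) : k^o := (a : {poly k})`_n.-1.

Lemma top_coef_is_linear : linear top_coef.
Proof. by move=> c a b; rewrite /top_coef coefD coefZ. Qed.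

HB.instance Definition _ := GRing.isLinear.Build k L k^o _ top_coef top_coef_is_linear.

(** Reduction modulo x^n does not affect the coefficient of x^(n-1), so products
    may be computed in k[x]. *)
Lemma top_coef_mul (a : L) p :
  top_coef (a * in_qpoly 'X^n p) = ((a : {poly k}) * p)`_n.-1.
Proof.
have coef_mod q : (in_qpoly 'X^n q : {poly k})`_n.-1 = q`_n.-1.
  rewrite val_in_qpoly // [in RHS](divp_eq q 'X^n) coefD coefMXn prednK // leqnn.
  by rewrite add0r.
by rewrite /top_coef -{1}(in_qpolyK a) -rmorphM coef_mod.
Qed.

(** The basis dual to the x^i for the pairing top_coef (a b) is x^(n-1-i). *)
Definition top_dual (h : L -> k^o) : L :=
  in_qpoly 'X^n (\poly_(i < n) h (in_qpoly 'X^n 'X^(n.-1 - i))).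

Lemma top_dualP (h : {linear L -> k^o}) (a : L) : top_coef (a * top_dual h) = h a.
Proof.
rewrite top_coef_mul coefM prednK // -[RHS]/(h a) -{2}(in_qpolyK a).
have {2}-> : (a : {poly k}) = \sum_(i < n) (a : {poly k})`_i *: 'X^i.
  rewrite -[LHS]coefK poly_def (big_ord_widen _ (fun i => a`_i *: 'X^i) (size_trunc a)).
  rewrite big_mkcond; apply: eq_bigr => i _; case: ltnP => // le_ai.
  by rewrite nth_default ?scale0r.
rewrite !linear_sum; apply: eq_bigr => i _; rewrite coef_poly.
have lt_in := ltn_ord i.
have -> : (n.-1 - i < n)%N by lia.
by rewrite !linearZ subKn //; lia.
Qed.

Lemma top_coef_nondeg (c : L) : (forall a, top_coef (a * c) = 0) -> c = 0.
Proof.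
move=> c0; apply/val_inj/polyP => i; rewrite coef0.
have [le_ni|lt_in] := leqP n i; first by rewrite nth_default // (leq_trans (size_trunc c)).
have := c0 (in_qpoly 'X^n 'X^(n.-1 - i)); rewrite mulrC top_coef_mul coefMXn.
by rewrite ltnNge leq_subr /= subKn //; lia.
Qed.
End TruncatedPolynomials.

(** * The matrix problem behind a bimodule summand *)

Section RightAction.
Variables (k : pzRingType) (A B : algType k) (M : bimodType A B).
Lemma ractBl (u v : M) (b : B) : (u - v) *> b = u *> b - v *> b.
Proof. by apply/(canRL (addrK _)); rewrite -ractDl subrK. Qed.
Lemma ractBr (v : M) (b c : B) : v *> (b - c) = v *> b - v *> c.
Proof. by apply/(canRL (addrK _)); rewrite -ractDr subrK. Qed.
Lemma ract0l (b : B) : (0 : M) *> b = 0.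
Proof. by rewrite -[X in X *> b](subrr 0) ractBl subrr. Qed.
End RightAction.

Section SplitTrace.
Variables (k : fieldType) (A B : algType k).
Hypothesis comA : forall a b : A, a * b = b * a.
Hypothesis comB : forall a b : B, a * b = b * a.
Variables (lA : {linear A -> k^o}) (lB : {linear B -> k^o}).
Variable dual : {linear A -> k^o} -> A.
Hypothesis dualP : forall h a, lA (a * dual h) = h a.
Hypothesis lA_nondeg : forall c, (forall a, lA (a * c) = 0) -> c = 0.

Variables (M : bimodType A B) (N : bimodType B A) (Y : bimodType B B).
Hypothesis Mfg : finitely_generated M.
Hypothesis Mproj : projective M.
Hypothesis iso : bimod_iso (tensor N M) (B^o * Y)%type.

(** The element e is the image of 1 under the inclusion of B; that inclusion is
    a bimodule morphism exactly when e commutes with B. *)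
Lemma bimod_iso_split : exists (phi : tensor N M -> B) (e : tensor N M),
  [/\ zmod_morphism phi, forall b t, phi (b *: t) = b * phi t,
   forall t b, phi (t *> b) = phi t * b, phi e = 1 & forall b, b *: e = e *> b].
Proof.
have [f [g fK gK] fr] := iso.
exists (fun t => (f t).1), (g (1, 0)); split=> [t u|b t|t b||b].
- by rewrite raddfB.
- by rewrite linearZ.
- by rewrite fr.
- by rewrite gK.
apply: (can_inj fK); rewrite linearZ fr gK.
congr pair => /=.
  by rewrite [LHS]mulr1 [RHS]mul1r.
by rewrite scaler0; exact/esym/ract0l.
Qed.

(** The coordinates s split the surjection from a free module onto the
    generators g; that splitting is where projectivity enters. *)
Lemma finite_dual_basis : exists r (g : 'I_r -> M) (s : M -> 'rV[A]_r),
  [/\ zmod_morphism s, forall a v, s (a *: v) = a *: s v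
   & forall v, v = \sum_i s v 0 i *: g i].
Proof.
have [r [g gen]] := Mfg.
pose p (u : 'rV[A]_r) := \sum_i u 0 i *: g i.
have plin : linear p.
  move=> a u v; rewrite /p scaler_sumr -big_split; apply: eq_bigr => i _ /=.
  by rewrite !mxE scalerDl scalerA.
pose pl := GRing.isLinear.Build _ _ _ _ p plin.
pose P : {linear 'rV[A]_r -> M} := HB.pack p pl.
pose I : {linear M -> M} := idfun.
have [v|s sP] := @Mproj _ _ P I.
  by have [c ->] := gen v; exists (\row_i c i); apply: eq_bigr => i _; rewrite mxE.
exists r, g, s; split => [u v|a v|v]; rewrite ?raddfB ?linearZ //.
by rewrite -[LHS]sP.
Qed.

(** Here W is the matrix of the endomorphism of M attached to e by the pairing
    between N and M, and rho b that of the right action of b, both extended by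
    zero from M to the free module of which M is a summand.  Hence rho need not
    map 1 to the identity matrix. *)
Lemma split_trace : exists r (W : 'M[A]_r) (rho : B -> 'M[A]_r),
  [/\ zmod_morphism rho,
      forall b c, rho (b * c) = rho b *m rho c,
      forall b, W *m rho b = rho b *m W
    & forall b, lA (\tr (W *m rho b)) = lB b].
Proof.
have [phi [e [phiB phiZ phiR phie ec]]] := bimod_iso_split.
have [r [g [s [sB sZ gs]]]] := finite_dual_basis.
have [tDl tDr tB] := @tens_balanced _ _ _ _ N M.
have phi0 : phi 0 = 0 by rewrite -[X in phi X]subr0 phiB subrr.
have phiD t u : phi (t + u) = phi t + phi u.
  by rewrite -[u in LHS]opprK phiB -[- u]sub0r phiB phi0 sub0r opprK.
have sD u v : s (u + v) = s u + s v.
  have s0 : s 0 = 0 by rewrite -[X in s X]subr0 sB subrr.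
  by rewrite -[v in LHS]opprK sB -[- v]sub0r sB s0 sub0r opprK.
pose beta n v := lB (phi (tens n v)).
have hlin n v : linear (fun a => beta n (a *: v) : k^o).
  move=> c a a'; rewrite /beta scalerDl tDr phiD linearD; congr (_ + _).
  rewrite -[c *: a]mulr_algl -scalerA -tB ractC -tensZl phiZ.
  by rewrite mulr_algl linearZ.
pose h n v : {linear A -> k^o} :=
  HB.pack (fun a => beta n (a *: v) : k^o) (GRing.isLinear.Build _ _ _ _ _ (hlin n v)).
pose lam n v := dual (h n v).
have lamE n v a : lA (a * lam n v) = beta n (a *: v) by rewrite dualP.
have lam_ext n v c : (forall a, beta n (a *: v) = lA (a * c)) -> lam n v = c.
  move=> H; apply/eqP; rewrite -subr_eq0; apply/eqP/lA_nondeg => a.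
  by rewrite mulrBr linearB lamE H subrr.
have lamDl n n' v : lam (n + n') v = lam n v + lam n' v.
  by apply: lam_ext => a; rewrite mulrDr linearD !lamE /beta tDl phiD linearD.
have lamDr n v v' : lam n (v + v') = lam n v + lam n v'.
  by apply: lam_ext => a; rewrite mulrDr linearD !lamE /beta scalerDr tDr phiD linearD.
have lamZ n v a : lam n (a *: v) = a * lam n v.
  by apply: lam_ext => b; rewrite mulrA lamE scalerA.
have lamA n v a : lam (n *> a) v = lam n v * a.
  apply: lam_ext => b; rewrite [b * _]comA -mulrA [_ * (a * b)]comA.
  by rewrite lamE /beta tB scalerA.
have lamB n v b : lam (b *: n) v = lam n (v *> b).
  apply: lam_ext => a; rewrite lamE /beta -tensZl phiZ comB -phiR.
  by rewrite tens_act ractZ.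
have lam0 n : lam n 0 = 0 by rewrite -(scale0r 0) lamZ mul0r.
have lam_sum n v : lam n v = \sum_i s v 0 i * lam n (g i).
  rewrite [in LHS](gs v) (big_morph (lam n) (lamDr n) (lam0 n)).
  by apply: eq_bigr => i _; rewrite lamZ.
(* The rank one endomorphism lam n (-) *: v, acting on row coordinates. *)
pose ev n v : 'M[A]_r := \matrix_(i, j) (lam n (g i) * s v 0 j).
have evP : balanced ev.
  split=> *; apply/matrixP => i j; rewrite !mxE.
  - by rewrite lamDl mulrDl.
  - by rewrite sD mxE mulrDr.
  - by rewrite lamA sZ mxE mulrA.
pose Ev := tensor_lift ev.
have EvB : zmod_morphism Ev by exact: tensor_liftB.
have EvE n v : Ev (tens n v) = ev n v by exact: tensor_liftE.
pose rho b : 'M[A]_r := \matrix_i s (g i *> b).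
have s0 : s 0 = 0 by rewrite -[X in s X]subr0 sB subrr.
have srho v b : s v *m rho b = s (v *> b).
  rewrite [in RHS](gs v) (big_morph (fun v : M => v *> b) (fun u v => ractDl u v b) (ract0l M b)).
  rewrite (big_morph s sD s0); apply/rowP => j; rewrite !mxE summxE.
  by apply: eq_bigr => i _; rewrite ractZ sZ !mxE.
have Evr t b : Ev t *m rho b = Ev (t *> b).
  apply: (tensor_ext (f := fun t => Ev t *m rho b) (g := fun t => Ev (t *> b))).
  - by move=> u v; rewrite EvB mulmxBl.
  - by move=> u v; rewrite -EvB ractBl.
  move=> n v; rewrite tens_act !EvE; apply/matrixP => i j.
  rewrite mxE [RHS]mxE -srho mxE mulr_sumr; apply: eq_bigr => l _.
  by rewrite !mxE mulrA.
have Evl t b : rho b *m Ev t = Ev (b *: t).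
  apply: (tensor_ext (f := fun t => rho b *m Ev t) (g := fun t => Ev (b *: t))).
  - by move=> u v; rewrite EvB mulmxBr.
  - by move=> u v; rewrite scalerBr EvB.
  move=> n v; rewrite tensZl !EvE; apply/matrixP => i j.
  rewrite mxE [RHS]mxE lamB lam_sum mulr_suml; apply: eq_bigr => l _.
  by rewrite !mxE mulrA.
have Evtr t : lA (\tr (Ev t)) = lB (phi t).
  apply: (tensor_ext (f := fun t => lA (\tr (Ev t))) (g := fun t => lB (phi t))).
  - by move=> u v; rewrite EvB !raddfB.
  - by move=> u v; rewrite phiB raddfB.
  move=> n v; rewrite EvE -[RHS]/(beta n v) -[v in RHS]scale1r -lamE mul1r.
  congr (lA _); rewrite [RHS]lam_sum; apply: eq_bigr => i _.
  by rewrite mxE comA.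
exists r, (Ev e), rho; split=> [b c|b c|b|b].
- by apply/row_matrixP => i; rewrite raddfB /= !rowK -sB; congr (s _); apply: ractBr.
- by apply/row_matrixP => i; rewrite row_mul !rowK srho ractA.
- by rewrite Evr Evl ec.
- by rewrite Evr Evtr phiR phie mul1r.
Qed.
End SplitTrace.

(** * Truncated polynomial algebras *)

(** Taking b = y^(m-1) in [split_trace] produces a trace with top coefficient 1,
    which [trunc_trace_eq0] says is zero. *)
Lemma trunc_poly_not_retract (k : fieldType) (n m : nat)
    (M : bimodType (trunc_poly k n) (trunc_poly k m))
    (N : bimodType (trunc_poly k m) (trunc_poly k n))
    (Y : bimodType (trunc_poly k m) (trunc_poly k m)) :
  (0 < n < m)%N -> finitely_generated M -> projective M ->
  ~ bimod_iso (tensor N M) ((trunc_poly k m)^o * Y)%type.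
Proof.
move=> /andP[n0 lt_nm] Mfg Mproj iso.
have m0 : (0 < m)%N by lia.
pose x : {poly %/ ('X^m : {poly k})} := in_qpoly 'X^m 'X.
have [r [W [rho [rhoB rhoM Wrho tr]]]] :=
  @split_trace k (trunc_poly k n) (trunc_poly k m) (@mulrC {poly %/ ('X^n : {poly k})})
   (@mulrC {poly %/ ('X^m : {poly k})}) (@top_coef k n) (@top_coef k m)
   (@top_dual k n) (@top_dualP k n n0) (@top_coef_nondeg k n n0) M N Y Mfg Mproj iso.
have rhoX i : rho (x ^+ i.+1) = (rho x : 'M[{poly %/ ('X^n : {poly k})}]_r) ^+ i.+1.
  elim: i => [|i IH]; first by rewrite !expr1.
  by rewrite exprS [RHS]exprS -IH; apply: rhoM.
have rho0 : rho 0 = 0 by rewrite -[X in rho X](subrr 0) rhoB subrr.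
have xX i : x ^+ i = in_qpoly 'X^m 'X^i by rewrite /x rmorphXn.
have xm : x ^+ m = 0 by apply/eqP; rewrite xX in_qpoly_eq0 // dvdpp.
have rhom : (rho x : 'M[{poly %/ ('X^n : {poly k})}]_r) ^+ m = 0.
  by rewrite -(prednK m0) -rhoX prednK // xm.
have /eqP := trunc_trace_eq0 n0 lt_nm rhom (Wrho x).
have -> : m.-1 = m.-2.+1 by lia.
rewrite -rhoX prednK; last by lia.
move=> tr0; have := tr (x ^+ m.-1); rewrite Wrho.
have -> : \tr (rho (x ^+ m.-1) *m W) = 0 by apply/eqP.
have top1 : top_coef (x ^+ m.-1) = 1.
  by rewrite xX -[in_qpoly _ _]mul1r top_coef_mul // mul1r coefXn eqxx.
rewrite linear0 => /esym/(etrans (esym top1))/eqP.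
by rewrite oner_eq0.
Qed.

Theorem theorem8 (k : closedFieldType) (n m : nat) :
  (0 < n)%N -> (0 < m)%N -> (n <= 6)%N -> m <> n ->
  ~ separably_equivalent (trunc_poly k n) (trunc_poly k m).
Proof.
move=> n0 m0 _ neq_mn [M [N [X [Y]]]].
case=> -[Mfg Mproj _ _] [Nfg Nproj _ _] isoA isoB.
have [lt_nm|lt_mn|/esym //] := ltngtP n m.
  by apply: (trunc_poly_not_retract _ Mfg Mproj isoB); rewrite n0.
by apply: (trunc_poly_not_retract _ Nfg Nproj isoA); rewrite m0.
Qed.
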